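(* For every $c\in\mathbb{C}$ with $0\le |c|<\frac14$, one has $\lambda(K^{+}(f_c))=+\infty$.
   Context: For $c\in\mathbb{C}$, $f_c:\mathbb{C}^2\to\mathbb{C}^2$ is the map $f_c(x,y)=(xy+c,x)$. The forward filled Julia set is $K^{+}(f_c)=\{z\in\mathbb{C}^2:\ \sup_{n\ge 0}\|f_c^{n}(z)\|<\infty\}$, where $\|(x,y)\|=\max\{|x|,|y|\}$. $\lambda$ denotes Lebesgue measure on $\mathbb{C}^2$ (identified with $\mathbb{R}^4$). *)

(* Defs.v *)
From HB Require Import structures.
From mathcomp Require Import all_boot all_order all_algebra.
From mathcomp Require Import all_classical all_reals all_analysis.
From mathcomp Require Export complex.

Set Implicit Arguments.
Unset Strict Implicit.
Unset Printing Implicit Defensive.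

Import Order.TTheory GRing.Theory Num.Theory.

Local Open Scope classical_set_scope.
Local Open Scope ring_scope.
Local Open Scope complex_scope.

(* The modulus is taken with values in [R] ([Normc.normc]); the norm [`|z|] of
   [z : R[i]] would be an element of [R[i]]. *)
Definition C2_norm (R : realType) (z : R[i] * R[i]) : R :=
  Num.max (Normc.normc z.1) (Normc.normc z.2).

Definition julia_map (R : realType) (c : R[i]) (z : R[i] * R[i]) : R[i] * R[i] :=
  (z.1 * z.2 + c, z.1).

(* The supremum is taken in the extended reals, so that it is [+oo] exactly
   when the forward orbit is unbounded. *)
Definition filled_julia (R : realType) (c : R[i]) : set (R[i] * R[i]) :=
  [set z | (ereal_sup [set (C2_norm (iter n (julia_map c) z))%:E | n in [set: nat]]
            < +oo)%E].

Definition C2_of_R4 (R : realType) (w : (R * R) * (R * R)) : R[i] * R[i] :=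
  (w.1.1 +i* w.1.2, w.2.1 +i* w.2.2).

Definition R2_lebesgue (R : realType) :
    set (measurableTypeR R * measurableTypeR R) -> \bar R :=
  (@lebesgue_measure R \x @lebesgue_measure R)%E.

(* A named product with its own instances, because the sigma-finite structure of
   a product [m1 \x m2] is not inferred (the subprobability instance shadows it). *)
HB.instance Definition _ (R : realType) := Measure.on (@R2_lebesgue R).

Lemma R2_lebesgue_sigma_finite (R : realType) :
  sigma_finite setT (@R2_lebesgue R).
Proof.
have /sigma_finiteP[F [TF ndF Foo]] := sigma_finiteT (@lebesgue_measure R).
exists (fun n => F n `*` F n).
  apply/seteqP; split=> // -[x y] _.
  have [n _ Fnx] : (\bigcup_i F i) x by rewrite -TF.
  have [k _ Fky] : (\bigcup_i F i) y by rewrite -TF.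
  exists (maxn n k) => //; split => /=.
  - by move: x Fnx; exact/subsetPset/ndF/leq_maxl.
  - by move: y Fky; exact/subsetPset/ndF/leq_maxr.
move=> k; have [mF Fk] := Foo k; split; first exact: measurableX.
by rewrite /R2_lebesgue product_measure1E// lte_mul_pinfty// ge0_fin_numE.
Qed.

HB.instance Definition _ (R : realType) :=
  Measure_isSigmaFinite.Build _ _ _ (@R2_lebesgue R)
    (@R2_lebesgue_sigma_finite R).

(* Lebesgue measure on R^4 as the iterated product of the Lebesgue measure on R
   (that is, its restriction to Borel sets), transported along [C2_of_R4].
   Like any measure of the library it is meaningful on measurable sets only;
   [filled_julia c], a countable union of closed sets, is one. *)
Definition C2_lebesgue (R : realType) (A : set (R[i] * R[i])) : \bar R :=
  (@R2_lebesgue R \x @R2_lebesgue R)%E (@C2_of_R4 R @^-1` A).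

(* Main.v *)
(** Put q = |c| < 1/4.  The bidisc {|x| <= 1/2, |y| <= 1/2} is mapped into
    itself, since 1/4 + q <= 1/2.  A point with |x| <= 1/2 and |xy| <= 1/4 enters
    it after one step, so its orbit is bounded.  The set of these points has
    infinite measure: for |y| of order 2^k it contains all x with |x| of order at
    most 2^-k, hence a box whose volume does not depend on k, and the boxes for
    distinct k are disjoint. *)
Require Import Defs.
From mathcomp Require Import all_boot all_order all_algebra.
From mathcomp Require Import all_classical all_reals all_analysis.
From mathcomp Require Import measurable_realfun.
From mathcomp Require Import ring lra.

Import Order.TTheory GRing.Theory Num.Theory.

Local Open Scope ring_scope.
Local Open Scope complex_scope.

Section ForwardOrbit.
Local Open Scope classical_set_scope.
Context {R : realType}.
Implicit Types (c : R[i]) (z : R[i] * R[i]).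

Lemma normc_ge0 (z : R[i]) : 0 <= Normc.normc z.
Proof. by case: z => a b; exact: sqrtr_ge0. Qed.

(** Turns coordinate bounds on a box into bounds on the modulus free of square roots. *)
Lemma normc_le_abs (a b : R) : Normc.normc (a +i* b) <= `|a| + `|b|.
Proof.
rewrite /= -[leRHS]ger0_norm ?addr_ge0// -sqrtr_sqr ler_sqrt ?sqr_ge0//.
rewrite sqrrD !real_normK ?num_real// lerD2r lerDl.
by rewrite mulrn_wge0// mulr_ge0.
Qed.

Lemma julia_bidisc_invariant {c z} : Normc.normc c <= 1 / 4 ->
  C2_norm z <= 1 / 2 -> C2_norm (julia_map c z) <= 1 / 2.
Proof.
move=> c4; rewrite /C2_norm !ge_max /= => /andP[x2 y2]; rewrite x2 andbT.
apply: le_trans (le_normcD _ _) _; rewrite Normc.normcM.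
have := normc_ge0 z.1; have := normc_ge0 z.2; nra.
Qed.

Lemma filled_julia_bounded (B : R) c z :
  (forall n, C2_norm (iter n (julia_map c) z) <= B) -> filled_julia c z.
Proof.
move=> zB; apply: le_lt_trans (ltry B); apply: ge_ereal_sup => _ [n _ <-].
by rewrite lee_fin.
Qed.

Lemma filled_julia_small_product c z : Normc.normc c <= 1 / 4 ->
  Normc.normc z.1 <= 1 / 2 -> Normc.normc z.1 * Normc.normc z.2 <= 1 / 4 ->
  filled_julia c z.
Proof.
(* [z.2] may be large, so iterate 0 is bounded by its own norm; all later iterates stay in the
   bidisc of radius 1/2. *)
move=> c4 x2 xy4; apply: (@filled_julia_bounded (Num.max (C2_norm z) (1 / 2))).
case=> [|n]; rewrite le_max ?lexx//; apply/orP; right.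
elim: n => [|n IHn]; last exact: julia_bidisc_invariant.
rewrite /C2_norm ge_max /= x2 andbT.
apply: le_trans (le_normcD _ _) _; rewrite Normc.normcM; lra.
Qed.

End ForwardOrbit.

Section Measurability.
Local Open Scope classical_set_scope.
Context {R : realType}.

Let R4 := ((measurableTypeR R * measurableTypeR R) *
           (measurableTypeR R * measurableTypeR R))%type.

(** Working with the two real coordinates reduces sums, products and moduli to real-valued
    measurable functions. *)
Definition measurable_complex {d} {T : measurableType d} (f : T -> R[i]) :=
  measurable_fun setT (fun w => complex.Re (f w) : R) /\
  measurable_fun setT (fun w => complex.Im (f w) : R).

Lemma measurable_complexD_cst {d} {T : measurableType d} (f : T -> R[i]) c :
  measurable_complex f -> measurable_complex (fun w => f w + c).
Proof.
move=> [fr fi]; split.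
- have -> : (fun w => complex.Re (f w + c)) = (fun w => complex.Re (f w) + complex.Re c).
    by apply/funext => w; case: (f w) => a b; case: (c).
  exact: measurable_funD.
- have -> : (fun w => complex.Im (f w + c)) = (fun w => complex.Im (f w) + complex.Im c).
    by apply/funext => w; case: (f w) => a b; case: (c).
  exact: measurable_funD.
Qed.

Lemma measurable_complexM {d} {T : measurableType d} (f g : T -> R[i]) :
  measurable_complex f -> measurable_complex g ->
  measurable_complex (fun w => f w * g w).
Proof.
move=> [fr fi] [gr gi]; split.
- have -> : (fun w => complex.Re (f w * g w)) =
            (fun w => complex.Re (f w) * complex.Re (g w) - complex.Im (f w) * complex.Im (g w)).
    by apply/funext => w; case: (f w) => a b; case: (g w).
  by apply: measurable_funB; exact: measurable_funM.
- have -> : (fun w => complex.Im (f w * g w)) =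
            (fun w => complex.Re (f w) * complex.Im (g w) + complex.Im (f w) * complex.Re (g w)).
    by apply/funext => w; case: (f w) => a b; case: (g w).
  by apply: measurable_funD; exact: measurable_funM.
Qed.

Lemma measurable_normc {d} {T : measurableType d} (f : T -> R[i]) :
  measurable_complex f -> measurable_fun setT (fun w => Normc.normc (f w) : R).
Proof.
move=> [fr fi].
have -> : (fun w => Normc.normc (f w)) =
          Num.sqrt \o (fun w => complex.Re (f w) ^+ 2 + complex.Im (f w) ^+ 2).
  by apply/funext => w /=; case: (f w).
apply: measurableT_comp.
  by apply: continuous_measurable_fun; exact: sqrt_continuous.
by apply: measurable_funD; exact: measurable_funX.
Qed.

Lemma measurable_julia_iter (c : R[i]) n :
  measurable_complex (fun w : R4 => (iter n (julia_map c) (C2_of_R4 w)).1) /\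
  measurable_complex (fun w : R4 => (iter n (julia_map c) (C2_of_R4 w)).2).
Proof.
elim: n => [|n [mx my]] /=.
  split; split => /=.
  - exact: (measurableT_comp measurable_fst measurable_fst).
  - exact: (measurableT_comp measurable_snd measurable_fst).
  - exact: (measurableT_comp measurable_fst measurable_snd).
  - exact: (measurableT_comp measurable_snd measurable_snd).
split=> //.
by apply: (measurable_complexD_cst _ c); exact: measurable_complexM.
Qed.

(** Links the supremum in [filled_julia] to tail suprema, whose measurability is known. *)
Lemma esups0 (u : nat -> \bar R) : esups u 0%N = ereal_sup (range u).
Proof.
by congr ereal_sup; apply/seteqP; split=> _ [n _ <-]; exists n.
Qed.

(** The set is where a pointwise supremum of countably many measurable functions, the norms of the
    iterates, is below [+oo]. *)
Lemma measurable_filled_julia (c : R[i]) :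
  measurable (@C2_of_R4 R @^-1` filled_julia c : set R4).
Proof.
pose u n (w : R4) := (C2_norm (iter n (julia_map c) (C2_of_R4 w)))%:E.
have mu n : measurable_fun setT (u n).
  apply/measurable_EFinP; have [mx my] := measurable_julia_iter c n.
  by apply: measurable_maxr; exact: measurable_normc.
have := emeasurable_fun_infty_o measurableT
  (measurable_fun_esups mu 0%N) +oo%E.
rewrite setTI; congr measurable; apply/funext => w.
by rewrite /= esups0.
Qed.

End Measurability.

Section Boxes.
Local Open Scope classical_set_scope.
Context {R : realType}.

Let R4 := ((measurableTypeR R * measurableTypeR R) *
           (measurableTypeR R * measurableTypeR R))%type.

(** The constant 32 is chosen so that [|x| <= 2 / (32 * a)] and [|y| <= 3 * a] give
    [|xy| <= 6/32 < 1/4]. The half-open range of [Re y] makes the boxes for [a = 2 ^+ k]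
    disjoint. *)
Definition julia_box (a : R) : set R4 :=
  (`[0, (32 * a)^-1] `*` `[0, (32 * a)^-1]) `*` (`[a, 2 * a[ `*` `[0, a]).

Lemma measurable_julia_box (a : R) : measurable (julia_box a).
Proof. by do 2!apply: measurableX; apply: measurable_itv. Qed.

Lemma R2_lebesgueX (A B : set (measurableTypeR R)) :
  measurable A -> measurable B ->
  R2_lebesgue (A `*` B) = (lebesgue_measure A * lebesgue_measure B)%E.
Proof. exact: product_measure1E. Qed.

Lemma measure_julia_box (a : R) : 0 < a ->
  (@R2_lebesgue R \x @R2_lebesgue R)%E (julia_box a) = (1 / 1024)%:E.
Proof.
move=> a0; have r0 : 0 < (32 * a)^-1 by rewrite invr_gt0; lra.
have a2a : a < 2 * a by lra.
rewrite /julia_box product_measure1E; [|exact: measurableX..].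
rewrite /= !R2_lebesgueX; [|exact: measurable_itv..].
rewrite !lebesgue_measure_itv /= !lte_fin r0 a2a a0 -!EFinB -!EFinM.
by congr EFin; field; rewrite gt_eqF.
Qed.

Lemma julia_box_sub (c : R[i]) (a : R) : Normc.normc c <= 1 / 4 -> 1 <= a ->
  julia_box a `<=` @C2_of_R4 R @^-1` filled_julia c.
Proof.
move=> c4 a1 [[x1 x2] [y1 y2]] [[/= X1 X2] [/= Y1 Y2]].
move: X1 X2 Y1 Y2; rewrite !in_itv /= => /andP[x10 x1r] /andP[x20 x2r].
move=> /andP[y1a y12a] /andP[y20 y2a].
set r := (32 * a)^-1 in x1r x2r *.
have ra : r * a = 1 / 32 by rewrite /r; field; lra.
have r0 : 0 < r by rewrite invr_gt0; lra.
have nx : Normc.normc (x1 +i* x2) <= 2 * r.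
  by apply: le_trans (normc_le_abs _ _) _; rewrite !ger0_norm//; lra.
have ny : Normc.normc (y1 +i* y2) <= 3 * a.
  by apply: le_trans (normc_le_abs _ _) _; rewrite !ger0_norm//; lra.
apply: filled_julia_small_product => //.
(* Since [1 <= a], [r <= r * a = 1/32], so [2 * r <= 1/2]. *)
- by apply: le_trans nx _; nra.
- apply: le_trans (ler_pM (normc_ge0 _) (normc_ge0 _) nx ny) _; lra.
Qed.

Lemma trivIset_julia_box : trivIset setT (fun k => julia_box (2 ^+ k)).
Proof.
suff H i j w : (i < j)%N -> julia_box (2 ^+ i) w -> julia_box (2 ^+ j) w -> False.
  by apply/trivIsetP => i j _ _; rewrite neq_ltn => /orP[] ij;
    apply/seteqP; split => // w [wi wj]; [exact: (H i j w)|exact: (H j i w)].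
move=> ij [_ [/= + _]] [_ [/= + _]].
rewrite !in_itv /= => /andP[_ w1] /andP[w2 _].
(* The real part of [y] would give [2^j < 2^(i+1)], against [i + 1 <= j]. *)
have := le_lt_trans w2 w1; rewrite -exprS ltNge => /negP; apply.
by rewrite ler_weXn2l// ler1n.
Qed.

End Boxes.

Theorem proposition2p12 (R : realType) (c : R[i])
  (hc : 0 <= Normc.normc c < 1 / 4) :
  C2_lebesgue (filled_julia c) = +oo%E.
Proof.
have /andP[_ /ltW c4] := hc.
have mbox k : measurable (@julia_box R (2 ^+ k)) by exact: measurable_julia_box.
apply/eqP; rewrite eq_le leey /=.
have sub : (\bigcup_k @julia_box R (2 ^+ k) `<=`
            @C2_of_R4 R @^-1` filled_julia c)%classic.
  by move=> w [k _]; apply: julia_box_sub => //; rewrite exprn_ege1// ler1n.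
apply: (@le_trans _ _ ((@R2_lebesgue R \x @R2_lebesgue R)%E
    (\bigcup_k julia_box (2 ^+ k))%classic)); last first.
  (* Monotonicity of the measure requires both sets to be measurable. *)
  apply: le_measure sub; rewrite inE; first exact: bigcupT_measurable.
  exact: measurable_filled_julia.
rewrite measure_semi_bigcup//; last 2 first.
- exact: trivIset_julia_box.
- exact: bigcupT_measurable.
rewrite (eq_eseriesr (g := fun=> (1 / 1024)%:E)); last first.
  by move=> k _; apply: measure_julia_box; rewrite exprn_gt0.
rewrite leye_eq; apply/eqP/eq_infty => r.
(* Each box contributes 1/1024, so a partial sum with more than [1024 * r] terms exceeds [r]. *)
apply: le_trans (nneseries_lim_ge (Num.truncn (1024 * r)).+1 _); last first.
  by move=> *; rewrite lee_fin; lra.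
rewrite sumEFin lee_fin sumr_const_nat subn0 -[leRHS]mulr_natr.
have := truncnS_gt (1024 * r); lra.
Qed.
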